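(* Let $\rho\in(0,1)$, $\kappa\ge1$ and $C>0$, and let $\mathcal{P}_{\rho,\kappa,C}(\mathcal{F})$ be the class of probability measures $P$ on $(S,\mathcal{A})$ such that, for all $\delta>0$ and all $n\ge1$, (i) $\omega_n(\mathcal{F};\delta)\le C\delta^{1-\rho}n^{-1/2}$; (ii) $D_P(\mathcal{F};\delta)\le C\delta^{\frac1{2\kappa}}$. Then $$\sup_{P\in\mathcal{P}_{\rho,\kappa,C}(\mathcal{F})}\mathbb{E}\,\mathcal{E}_P(\mathcal{F};\hat f_n)=O\big(n^{-\frac{\kappa}{2\kappa+\rho-1}}\big)\qquad(n\to\infty).$$
   Context: $(S,\mathcal{A})$ is a measurable space and $\mathcal{F}$ is a class of measurable functions $f:S\to[0,1]$. For a probability measure $P$ on $S$, $X_1,\dots,X_n$ are i.i.d. with distribution $P$ and $P_n$ is the empirical measure; measurability of suprema over function classes is assumed. $\mathcal{E}_P(\mathcal{F};f):=Pf-\inf_{g\in\mathcal{F}}Pg$; $\mathcal{F}(\delta):=\{f\in\mathcal{F}:\mathcal{E}_P(\mathcal{F};f)\le\delta\}$; $\hat f_n$ is a minimizer of $P_nf$ over $\mathcal{F}$ (assumed to exist). $\rho_P^2(f,g):=P(f-g)^2$; $D_P(\mathcal{F};\delta):=\sup_{f,g\in\mathcal{F}(\delta)}\rho_P(f,g)$; $$\omega_n(\mathcal{F};\delta):=\mathbb{E}\sup_{f,g\in\mathcal{F},\,\rho_P(f,g)\le\delta}|(P_n-P)(f-g)|.$$ *)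

(* Defs.v *)
From HB Require Import structures.
From mathcomp Require Import all_boot all_order all_algebra.
From mathcomp Require Import all_classical all_reals all_analysis measurable_realfun.
Set Implicit Arguments.
Unset Strict Implicit.
Unset Printing Implicit Defensive.
Import Order.TTheory GRing.Theory Num.Theory.
Import numFieldNormedType.Exports.
Local Open Scope classical_set_scope.
Local Open Scope ring_scope.

Section product_power.
Context d (S : measurableType d) (R : realType).

Definition tcons n (z : S * n.-tuple S) : n.+1.-tuple S :=
  [tuple of z.1 :: z.2].

Lemma measurable_tcons n : measurable_fun setT (@tcons n).
Proof. exact: measurable_cons. Qed.

HB.instance Definition _ n :=
  isMeasurableFun.Build _ _ _ _ (@tcons n) (@measurable_tcons n).

(* [prob_power P n] is the n-fold product of P on n.-tuple S, i.e. the law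
   under which the coordinates X_1, ..., X_n are i.i.d. with distribution P
   (see [prob_power_box]). *)
Fixpoint prob_power (P : probability S R) (n : nat) :
    probability (n.-tuple S) R :=
  match n with
  | 0 => dirac [tuple]
  | n'.+1 => distribution (P \x prob_power P n')%E (@tcons n')
  end.

Lemma prob_power_box (P : probability S R) n (A : 'I_n -> set S) :
  (forall i, measurable (A i)) ->
  prob_power P n [set x | forall i, A i (tnth x i)] = (\prod_(i < n) P (A i))%E.
Proof.
elim: n A => [|n IHn] A mA.
  rewrite big_ord0 /= diracE mem_set//= => -[]//.
rewrite big_ord_recl /= /distribution /pushforward.
have -> : @tcons n @^-1` [set x | forall i, A i (tnth x i)] =
    A ord0 `*` [set x : n.-tuple S | forall i, A (lift ord0 i) (tnth x i)].
  apply/seteqP; split=> [z /= Az|z /= [A0 Al] i].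
    split; first by have := Az ord0; rewrite tnth0.
    by move=> i; have := Az (lift ord0 i); rewrite tnthS.
  by case: (unliftP ord0 i) => [j|] ->; rewrite ?tnthS ?tnth0//; exact: Al.
rewrite product_measure1E//; last first.
  rewrite (_ : [set _ | _] = \bigcap_(i in setT)
      ((fun x : n.-tuple S => tnth x i) @^-1` A (lift ord0 i))); last first.
    by apply/seteqP; split=> [x h i _|x h i]; [exact: h|exact: (h i I)].
  apply: fin_bigcap_measurable; first exact: finite_finset.
  by move=> i _; rewrite -[X in measurable X]setTI; exact: measurable_tnth.
congr (_ * _)%E; exact: IHn.
Qed.

End product_power.

Section empirical_risk.
Context d (S : measurableType d) (R : realType).
Implicit Types (P : probability S R) (F : set (S -> R)) (f g : S -> R).

(* The risks are real-valued integrals: the functions integrated below are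
   built from measurable functions with values in [0, 1], hence integrable,
   and the infimum in [excess_risk] is over a set bounded below by 0. The
   suprema below are taken in \bar R. *)
Definition risk P f : R := \int[P]_s f s.

Definition emp_risk n (x : n.-tuple S) f : R :=
  n%:R^-1 * \sum_(i < n) f (tnth x i).

Definition excess_risk P F f : R := risk P f - inf [set risk P g | g in F].

Definition near_minimizers P F (delta : R) : set (S -> R) :=
  [set f | F f /\ excess_risk P F f <= delta].

Definition rho_dist P f g : R := Num.sqrt (risk P (fun s => (f s - g s) ^+ 2)).

Definition near_diameter P F (delta : R) : \bar R :=
  ereal_sup [set r | exists f g, near_minimizers P F delta f /\
    near_minimizers P F delta g /\ r = (rho_dist P f g)%:E].

Definition emp_process P n (x : n.-tuple S) f : R := emp_risk x f - risk P f.

(* Random variable whose expectation is [omega]: the supremum of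
   |(P_n - P)(f - g)| over pairs f, g in F at rho_dist at most delta. *)
Definition sup_increment P F n (delta : R) (x : n.-tuple S) : \bar R :=
  ereal_sup [set r | exists f g, F f /\ F g /\ rho_dist P f g <= delta /\
    r = `|emp_process P x (fun s => f s - g s)|%:E].

Definition omega P F n (delta : R) : \bar R :=
  (\int[prob_power P n]_x sup_increment P F delta x)%E.

Definition prob_class F (rho kappa C : R) : set (probability S R) :=
  [set P | forall (delta : R) (n : nat), 0 < delta -> (1 <= n)%N ->
    (omega P F n delta <= (C * delta `^ (1 - rho) * n%:R `^ (- 2^-1))%:E)%E /\
    (near_diameter P F delta <= (C * delta `^ (2 * kappa)^-1)%:E)%E].

(* The estimator is a function of the sample, and a minimizer of the empirical
   risk over F for every sample; in particular F is nonempty. *)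
Definition is_erm F (fhat : forall n, n.-tuple S -> S -> R) : Prop :=
  forall n (x : n.-tuple S), (1 <= n)%N ->
    F (fhat n x) /\ forall g, F g -> emp_risk x (fhat n x) <= emp_risk x g.

End empirical_risk.

(* Main.v *)
(* Let Z_n(r) be the supremum of |(P_n - P)(f - g)| over f, g in F at distance
   at most r. If delta < E(fhat) <= 2 delta, comparing fhat with a near minimizer
   g of the risk gives Z_n(r) > delta / 2 for r = C (2 delta)^(1/(2 kappa)).
   Instead of Talagrand's inequality, the probability of this event is bounded
   by a Hoffmann-Jorgensen inequality
     P(n Z_n > 3 t + 2) <= 2 (max_{j <= n} P(j Z_j > t))^2,
   where (i) and Markov's inequality control the right-hand side. The square
   makes the bound summable after multiplication by delta when delta runs over
   2^j delta_n, because (1 - rho) / kappa < 1; the sum is of the order of its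
   first scale delta_n = 8 n^(-kappa/(2 kappa + rho - 1)). *)
Require Import Defs.
From mathcomp Require Import all_boot all_order all_algebra.
From mathcomp Require Import all_classical all_reals all_analysis measurable_realfun.
From mathcomp Require Import ring lra.
Set Implicit Arguments.
Unset Strict Implicit.
Unset Printing Implicit Defensive.
Import Order.TTheory GRing.Theory Num.Theory.
Import numFieldNormedType.Exports.
Local Open Scope classical_set_scope.
Local Open Scope ring_scope.

(** * Prefixes and suffixes of an i.i.d. sample *)

Section iid_sequences.
Context d (S : measurableType d) (R : realType) (P : probability S R).

(* Events are predicates on sequences, so that prefixes and suffixes of a
   sample can be taken without casts between tuple types. *)
Definition seq_event n (A : set (seq S)) : set (n.-tuple S) := [set x | A x].
Arguments seq_event n A : clear implicits.

Lemma measurable_seq_event_take j m (A : set (seq S)) :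
  measurable (seq_event j A) ->
  measurable (seq_event (j + m) (fun s => A (take j s))).
Proof.
move=> mA; pose h (x : (j + m).-tuple S) := [tuple tnth x (lshift m i) | i < j].
have mh : measurable_fun setT h.
  apply/measurable_fun_tnthP => i.
  rewrite (_ : _ \o h = (@tnth _ S)^~ (lshift m i)); last first.
    by apply/funext => x /=; rewrite tnth_mktuple.
  exact: measurable_tnth.
rewrite (_ : seq_event _ _ = h @^-1` seq_event j A).
  by rewrite -[X in measurable X]setTI; exact: mh.
apply/seteqP; suff e (x : (j + m).-tuple S) : take j x = h x :> seq S.
  by split => x; rewrite /seq_event /= -e.
(* The empty prefix is treated apart because [thead x], the default element for [nth], needs a
   nonempty sample. *)
case: j A {mA} @h {mh} x => [|j] A h x.
  by rewrite take0; apply/esym/size0nil; rewrite size_tuple.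
apply: (@eq_from_nth _ (thead x)) => [|i].
  by rewrite size_takel ?size_tuple// leq_addr.
rewrite size_takel ?size_tuple ?leq_addr// => ij.
rewrite nth_take// -[i]/(val (Ordinal ij)) -tnth_nth /h tnth_mktuple.
by rewrite (tnth_nth (thead x)).
Qed.

Lemma measurable_seq_event_drop j m (B : set (seq S)) :
  measurable (seq_event m B) ->
  measurable (seq_event (j + m) (fun s => B (drop j s))).
Proof.
elim: j => [|j IH] mB; first by under eq_fun do rewrite drop0.
have := @measurable_behead _ S (j + m) measurableT _ (IH mB).
rewrite setTI; congr (measurable _).
by apply/seteqP; split => -[[|y s] //= sz]; rewrite /seq_event/=.
Qed.

Lemma xsection_tcons n (A : set (seq S)) (s : S) :
  xsection (@tcons _ S n @^-1` seq_event n.+1 A) s =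
  seq_event n [set t | A (s :: t)].
Proof. by apply/seteqP; split => x /=; rewrite /xsection/= ?inE. Qed.

Lemma measurable_tcons_preimage n (A : set (seq S)) :
  measurable (seq_event n.+1 A) ->
  measurable (@tcons _ S n @^-1` seq_event n.+1 A).
Proof.
by move=> mA; rewrite -[X in measurable X]setTI; exact: measurable_tcons.
Qed.

Lemma measurable_seq_event_cons n (A : set (seq S)) (s : S) :
  measurable (seq_event n.+1 A) ->
  measurable (seq_event n [set t | A (s :: t)]).
Proof.
move=> /measurable_tcons_preimage mA.
by rewrite -xsection_tcons; exact: measurable_xsection.
Qed.

Lemma prob_powerS n (A : set (seq S)) :
  prob_power P n.+1 (seq_event n.+1 A) =
  (\int[P]_s prob_power P n (seq_event n [set t | A (s :: t)]))%E.
Proof.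
rewrite /= /distribution /pushforward /product_measure1.
by apply: eq_integral => s _ /=; rewrite xsection_tcons.
Qed.

(** Independence of disjoint blocks, by induction on the prefix length: once [prob_powerS]
    integrates out the first observation [s], the prefix event becomes [A (s :: t)] on one
    observation less. *)
Lemma prob_power_take_drop j m (A B : set (seq S)) :
  measurable (seq_event j A) -> measurable (seq_event m B) ->
  prob_power P (j + m)
    (seq_event (j + m) (fun s => A (take j s) /\ B (drop j s))) =
  (prob_power P j (seq_event j A) * prob_power P m (seq_event m B))%E.
Proof.
elim: j A => [|j IH] A mA mB.
  rewrite /= diracE.
  have [A0|A0] := pselect (A [::]).
    rewrite mem_set// mul1e; congr (prob_power _ _ _).
    by apply/seteqP; split => x; rewrite /seq_event/= drop0 take0 => // -[].
  rewrite memNset// mul0e [X in prob_power _ _ X](_ : _ = set0) ?measure0//.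
  by apply/seteqP; split => x //; rewrite /seq_event/= take0 => -[].
rewrite addSn !prob_powerS -ge0_integralZr//.
- apply: eq_integral => s _; rewrite -IH//.
  exact: measurable_seq_event_cons.
- have := measurable_fun_xsection (prob_power P j) (measurable_tcons_preimage mA).
  apply: eq_measurable_fun => s _ /=.
  by rewrite xsection_tcons.
Qed.

End iid_sequences.
Arguments seq_event {d S} n A _.

(** * The shortest suffix of a sample that lies in an event *)

Section first_hit.
Context d (S : measurableType d) (R : realType) (P : probability S R).
Implicit Types E G Q : set (seq S).

(** Suffixes replace the prefixes of the classical argument because [prob_power] adds observations
    at the front. The empty suffix never counts as a hit. *)
Fixpoint suffix_hits E (s : seq S) : Prop :=
  if s is x :: s' then suffix_hits E s' \/ E s else False.

Lemma suffix_hitsS E n : seq_event n.+1 (suffix_hits E) =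
  seq_event n.+1 (fun s => suffix_hits E (drop 1 s)) `|` seq_event n.+1 E.
Proof.
by apply/seteqP; split => -[[|x s] //= sz]; rewrite /seq_event/= ?drop0.
Qed.

Lemma measurable_suffix_hits E n :
  (forall m, measurable (seq_event m E)) ->
  measurable (seq_event n (suffix_hits E)).
Proof.
move=> mE; elim: n => [|n IH].
  rewrite (_ : seq_event _ _ = set0)//.
  by apply/seteqP; split => x; rewrite /seq_event/= tuple0.
rewrite suffix_hitsS; apply: measurableU; last exact: mE.
exact: (@measurable_seq_event_drop _ _ 1 n).
Qed.

Let first_hit E s := ~ suffix_hits E (drop 1 s) /\ E s.

(* Decomposing along the shortest suffix that lies in E: that suffix is
   independent of the prefix preceding it. *)
Lemma prob_suffix_hits_le E G Q n (q : R) :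
  (forall m, measurable (seq_event m E)) ->
  (forall m, measurable (seq_event m G)) ->
  measurable (seq_event n Q) ->
  (forall s j, (j < size s)%N -> Q s -> E (drop j s) ->
    ~ suffix_hits E (drop j.+1 s) -> G (take j s)) ->
  (forall j, (j <= n)%N -> prob_power P j (seq_event j G) <= q%:E)%E ->
  (prob_power P n (seq_event n (fun s => suffix_hits E s /\ Q s)) <=
   q%:E * prob_power P n (seq_event n (suffix_hits E)))%E.
Proof.
move=> mE mG mQ QG Gq.
have mH m : measurable (seq_event m (suffix_hits E)).
  exact: measurable_suffix_hits.
have q0 : (0 <= q%:E)%E by exact: le_trans (measure_ge0 _ _) (Gq 0%N (leq0n n)).
have mF m : measurable (seq_event m.+1 (first_hit E)).
  rewrite [seq_event _ _](_ : _ =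
    seq_event m.+1 E `\` seq_event (1 + m) (fun s => suffix_hits E (drop 1 s))).
    apply: measurableD; first exact: mE.
    exact: (@measurable_seq_event_drop _ _ 1 m).
  by apply/seteqP; split => x []; rewrite /seq_event/=.
(* The sample is scanned from its end: m observations have been read, the first j have not. The
   induction is on m with n fixed. *)
suff H m j : (j + m)%N = n ->
    (prob_power P n (seq_event n (fun s => suffix_hits E (drop j s) /\ Q s)) <=
     q%:E * prob_power P m (seq_event m (suffix_hits E)))%E.
  by have := H n 0%N (add0n n); under eq_fun do rewrite drop0.
elim: m j => [|m IH] j jmn.
  rewrite [X in prob_power P n X](_ : _ = set0) ?measure0 ?mule_ge0//.
  apply/seteqP; split => // x [+ _] /=.
  by rewrite drop_oversize// size_tuple -jmn addn0.
(* A hit among m.+1 observations is either a hit among the last m or a first hit by the whole block,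
   and these events are disjoint. *)
have -> : prob_power P m.+1 (seq_event m.+1 (suffix_hits E)) =
    (prob_power P m (seq_event m (suffix_hits E)) +
     prob_power P m.+1 (seq_event m.+1 (first_hit E)))%E.
  have -> : prob_power P m (seq_event m (suffix_hits E)) = prob_power P m.+1
      (seq_event (1 + m) (fun s => setT (take 1 s) /\ suffix_hits E (drop 1 s))).
    rewrite (@prob_power_take_drop _ _ _ _ 1 m)//.
      by rewrite [X in prob_power P 1 X](_ : _ = setT) ?probability_setT ?mul1e.
    by rewrite [X in measurable X](_ : _ = setT).
  rewrite -measureU//.
  - congr (prob_power P m.+1 _); apply/seteqP; split => -[[|x s] //= sz];
      rewrite /seq_event /first_hit/= drop0.
      have [?|?] := pselect (suffix_hits E s); first by left.
      by case=> // ?; right.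
    by case=> -[]; [left|right].
  - rewrite [X in measurable X](_ : _ =
      seq_event (1 + m) (fun s => suffix_hits E (drop 1 s))).
      exact: (@measurable_seq_event_drop _ _ 1 m).
    by apply/seteqP; split => x; rewrite /seq_event/=; [case|].
  - exact: mF.
  - by apply/seteqP; split => // x; rewrite /seq_event/= /first_hit => -[[]] _ ? [].
rewrite ge0_muleDr//.
have jSn : (j.+1 + m)%N = n by rewrite addSnnS.
apply: le_trans (leeD (IH _ jSn) (lexx _)).
have mEHQ i k : (i + k)%N = n ->
    measurable (seq_event n (fun s => suffix_hits E (drop i s) /\ Q s)).
  move=> ikn; rewrite [seq_event _ _](_ : _ =
    seq_event n (fun s => suffix_hits E (drop i s)) `&` seq_event n Q)//.
  by apply: measurableI => //; rewrite -ikn; exact: measurable_seq_event_drop.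
(* When the first hit is the suffix starting at j, [Q] forces [G] on the prefix. The two conditions
   in [W] concern disjoint blocks, so its probability factorizes. *)
pose W := seq_event n (fun s => G (take j s) /\ first_hit E (drop j s)).
have mW : measurable W.
  rewrite /W [seq_event _ _](_ : _ = seq_event n (fun s => G (take j s)) `&`
    seq_event n (fun s => first_hit E (drop j s)))//.
  apply: measurableI; rewrite -jmn; first exact: measurable_seq_event_take.
  exact: measurable_seq_event_drop.
have Wle : (prob_power P n W <=
    q%:E * prob_power P m.+1 (seq_event m.+1 (first_hit E)))%E.
  have := prob_power_take_drop P (mG j) (mF m); rewrite jmn => ->.
  by apply: lee_wpmul2r => //; apply: Gq; rewrite -jmn leq_addr.
apply: le_trans (leeD (lexx _) Wle).
apply: le_trans (measureU2 _ _ mW); last exact: (mEHQ _ m).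
apply: le_measure; rewrite ?inE.
- exact: (mEHQ _ m.+1).
- by apply: measurableU => //; exact: (mEHQ _ m).
move=> x []; rewrite /W /seq_event/= => + Qx.
have jx : (j < size x)%N by rewrite size_tuple -jmn -addSnnS leq_addr.
case e : (drop j x) => [|y s].
  by move/(congr1 size): e => /= /eqP; rewrite size_drop subn_eq0 leqNgt jx.
have e' : drop j.+1 x = s by rewrite -add1n -drop_drop e/= drop0.
have [hs _|nhs [//|Ey]] := pselect (suffix_hits E s); first by left; rewrite e'.
right; split; last by rewrite /first_hit/= drop0.
by apply: QG; rewrite ?e ?e'.
Qed.

End first_hit.

(** * Hoffmann-Jorgensen inequality for an abstract norm of sums *)

Section hoffmann_jorgensen.
Context d (S : measurableType d) (R : realType) (P : probability S R).
(* [big t s] abstracts "the norm of the sum over s exceeds t", for summands of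
   norm at most 2. *)
Variable big : R -> set (seq S).
Hypothesis big_nil : forall t, 0 <= t -> ~ big t [::].
Hypothesis measurable_big : forall t, 0 < t ->
  forall n, measurable (seq_event n (big t)).
(** Triangle inequality for the sum over a concatenation; [big_suffix] is its counterpart for the
    suffix sum, seen as the whole sum minus the prefix sum. *)
Hypothesis big_cat : forall a b s1 s2,
  big (a + b) (s1 ++ s2) -> big a s1 \/ big b s2.
Hypothesis big_suffix : forall a b s1 s2,
  big (a + b) s2 -> big a s1 \/ big b (s1 ++ s2).
Hypothesis big1 : forall x, ~ big 2 [:: x].

Let big_le a b s : a <= b -> big b s -> big a s.
Proof.
move=> ab; rewrite -[b](subrK a) -[s]/([::] ++ s) => /big_cat[] // /big_nil[].
by rewrite subr_ge0.
Qed.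

(** Maximal inequality of Ottaviani type. Either the whole sum exceeds t, or the prefix preceding
    the shortest suffix of norm above 2t has norm above t. That prefix is independent of the suffix,
    hence p <= q + q p. *)
Lemma prob_suffix_hits_big n t q : 0 < t ->
  (forall j, (j <= n)%N -> (prob_power P j (seq_event j (big t)) <= q%:E)%E) ->
  (prob_power P n (seq_event n (suffix_hits (big (2 * t)))) <= (2 * q)%:E)%E.
Proof.
move=> t0 tq; set H := seq_event n _; set p := prob_power P n H.
have t20 : 0 < 2 * t by rewrite mulr_gt0.
have mH : measurable H by apply: measurable_suffix_hits; exact: measurable_big.
have mB : measurable (seq_event n (big t)) by exact: measurable_big.
have mHC : measurable (seq_event n (fun s => suffix_hits (big (2 * t)) s /\ ~ big t s)).
  rewrite [X in measurable X](_ : _ = H `\` seq_event n (big t))//.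
  exact: measurableD.
have pq : (p <= q%:E + q%:E * p)%E.
  apply: (@le_trans _ _ (prob_power P n (seq_event n (big t)) + prob_power P n
    (seq_event n (fun s => suffix_hits (big (2 * t)) s /\ ~ big t s)))%E).
    apply: le_trans (measureU2 _ mB mHC).
    apply: le_measure; rewrite ?inE//; first exact: measurableU.
    by move=> x Hx; have [|] := pselect (big t x); [left|right].
  apply: leeD; first exact: tq.
  apply: (@prob_suffix_hits_le _ _ _ _ _ (big t)) => //.
  - exact: measurable_big.
  - exact: measurable_big.
  - by rewrite [X in measurable X](_ : _ = ~` seq_event n (big t))//; exact: measurableC.
  move=> s j js nb b2 _; have : big (t + t) (drop j s) by rewrite -mulr2n -mulr_natl.
  by move=> /(@big_suffix _ _ (take j s)) []//; rewrite cat_take_drop.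
have p1 : (p <= 1)%E by exact: probability_le1.
have p0 : (0 <= p)%E by exact: measure_ge0.
have pf : p \is a fin_num by rewrite ge0_fin_numE// (le_lt_trans p1)// ltry.
move: pq p1 p0; rewrite -(fineK pf) -EFinM -EFinD !lee_fin => pq p1 p0.
(* Since p <= 1, the bound q + q p is at most 2 q. *)
by nra.
Qed.

(* At the shortest suffix with norm above 2t the norm is at most 2t + 2, so the
   complementary prefix, which is independent of it, has norm above t. *)
Lemma hoffmann_jorgensen n t q : 0 < t ->
  (forall j, (j <= n)%N -> (prob_power P j (seq_event j (big t)) <= q%:E)%E) ->
  (prob_power P n (seq_event n (big (3 * t + 2))) <= (2 * q ^+ 2)%:E)%E.
Proof.
move=> t0 tq.
have t20 : 0 < 2 * t by rewrite mulr_gt0.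
have q0 : 0 <= q.
  by rewrite -lee_fin; exact: le_trans (measure_ge0 _ _) (tq 0%N (leq0n n)).
have mB : measurable (seq_event n (big (3 * t + 2))) by apply: measurable_big; nra.
(* The factor q comes from the independent prefix, the factor 2 q from the maximal inequality. *)
rewrite (_ : 2 * q ^+ 2 = q * (2 * q)); last by ring.
rewrite EFinM; apply: (@le_trans _ _ (q%:E *
    prob_power P n (seq_event n (suffix_hits (big (2 * t)))))%E); last first.
  by apply: lee_wpmul2l; [rewrite lee_fin|exact: prob_suffix_hits_big].
apply: (@le_trans _ _ (prob_power P n (seq_event n (fun s =>
    suffix_hits (big (2 * t)) s /\ big (3 * t + 2) s)))).
  rewrite le_eqVlt; apply/orP; left; apply/eqP; congr (prob_power P n _).
  apply/seteqP; split => x; rewrite /seq_event/=; last by case.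
  move=> bx; split=> //; case: (tval x) bx => [/big_nil[]|y s bx]; first nra.
  by right; apply: big_le bx; nra.
apply: (@prob_suffix_hits_le _ _ _ _ _ (big t)) => //.
- exact: measurable_big.
- exact: measurable_big.
(* The threshold is shared among the prefix, the observation at position j and the rest; [big1] and
   the minimality of the hit exclude the last two. *)
move=> s j js bs _ nh; rewrite (_ : 3 * t + 2 = t + (2 + 2 * t)) in bs; last by ring.
move: bs; rewrite -{1}(cat_take_drop j s) => /big_cat[]//.
case: s js nh => // x0 s js nh; rewrite (drop_nth x0 js) -cat1s => /big_cat[/big1[]|].
case: (drop j.+1 _) nh => [_ /big_nil[]|y s' nh b2]; first exact: ltW.
by exfalso; apply: nh; right.
Qed.
End hoffmann_jorgensen.

(** * Risks and increments of the centered empirical process *)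

Section risk_theory.
Context d (S : measurableType d) (R : realType) (P : probability S R).
Variable F : set (S -> R).
Hypothesis F01 : forall f, F f -> measurable_fun setT f /\ forall s, 0 <= f s <= 1.

Lemma integrable_class f : F f -> P.-integrable setT (EFin \o f).
Proof.
move=> /F01[mf f01]; apply: measurable_bounded_integrable => //.
  by rewrite (le_lt_trans (probability_le1 P measurableT))// ltry.
exists 1; split => [|M M1 s _]; first exact: num_real.
have /andP[f0 f1] := f01 s; rewrite /= ger0_norm//.
exact: le_trans f1 (ltW M1).
Qed.

Lemma riskB f g : F f -> F g ->
  risk P (fun s => f s - g s) = risk P f - risk P g.
Proof. by move=> Ff Fg; apply: RintegralB => //; exact: integrable_class. Qed.

Lemma risk_itv01 f : F f -> 0 <= risk P f <= 1.
Proof.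
move=> Ff; have [mf f01] := F01 Ff; apply/andP; split.
  by apply: Rintegral_ge0 => s _; have /andP[] := f01 s.
have <- : \int[P]_(s in setT) (1 : R) = 1.
  rewrite Rintegral_cst//; have /= -> := probability_setT P; by rewrite mul1r.
apply: le_Rintegral => //; first exact: integrable_class.
  apply: measurable_bounded_integrable => //.
    by rewrite (le_lt_trans (probability_le1 P measurableT))// ltry.
  by exists 1; split => [|M M1 s _]; [exact: num_real|rewrite normr1 ltW].
by move=> s _; have /andP[] := f01 s.
Qed.

Lemma has_inf_risk f : F f -> has_inf [set risk P g | g in F].
Proof.
move=> Ff; split; first by exists (risk P f); exists f.
by exists 0 => _ [g Fg <-]; have /andP[] := risk_itv01 Fg.
Qed.

Lemma excess_risk_ge0 f : F f -> 0 <= excess_risk P F f.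
Proof.
move=> Ff; rewrite subr_ge0; apply: ge_inf; last by exists f.
by have [] := has_inf_risk Ff.
Qed.

Lemma excess_risk_le1 f : F f -> excess_risk P F f <= 1.
Proof.
move=> Ff; have /andP[_ f1] := risk_itv01 Ff.
rewrite lerBlDr (le_trans f1)// lerDl; apply: lb_le_inf.
  by exists (risk P f); exists f.
by move=> _ [g Fg <-]; have /andP[] := risk_itv01 Fg.
Qed.

Lemma near_minimizer_exists f e : F f -> 0 < e ->
  exists2 g, F g & excess_risk P F g < e.
Proof.
move=> Ff e0; have [_ [g Fg <-] ge] := inf_adherent e0 (has_inf_risk Ff).
by exists g => //; rewrite ltrBlDl.
Qed.

Definition centered_sum f g (s : seq S) : R :=
  \sum_(x <- s) (f x - g x - risk P (fun y => f y - g y)).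

Lemma emp_processE f g n (x : n.-tuple S) : (0 < n)%N ->
  n%:R * emp_process P x (fun s => f s - g s) = centered_sum f g x.
Proof.
move=> n0; rewrite /emp_process /emp_risk mulrBr mulrA mulfV ?mul1r; last first.
  by rewrite pnatr_eq0 -lt0n.
rewrite [RHS]sumrB big_tuple; congr (_ - _).
by rewrite big_const_seq count_predT size_tuple iter_addr addr0 mulr_natl.
Qed.

(* The sum runs over n times P_n - P, so that the process has independent
   increments in n. *)
Definition large_increment (r t : R) : set (seq S) := [set s | exists f g,
  [/\ F f, F g, rho_dist P f g <= r & t < `|centered_sum f g s|] ].

Lemma large_increment_le r (a b : R) s : a <= b ->
  large_increment r b s -> large_increment r a s.
Proof.
by move=> ab [f [g [? ? ? bs]]]; exists f, g; split=> //; exact: le_lt_trans bs.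
Qed.

Lemma large_increment_nil r (t : R) : 0 <= t -> ~ large_increment r t [::].
Proof.
by move=> t0 [f [g [_ _ _]]]; rewrite /centered_sum big_nil normr0 ltNge t0.
Qed.

(** Both f - g and its mean lie in [-1, 1], which gives the constant 2. *)
Lemma large_increment1 r x : ~ large_increment r 2 [:: x].
Proof.
move=> [f [g [Ff Fg _]]]; apply/negP; rewrite -leNgt.
rewrite /centered_sum big_seq1 riskB//.
have [_ /(_ x) f01] := F01 Ff; have [_ /(_ x) g01] := F01 Fg.
have := risk_itv01 Ff; have := risk_itv01 Fg; rewrite ler_norml; lra.
Qed.

Lemma large_increment_cat r (a b : R) s1 s2 :
  large_increment r (a + b) (s1 ++ s2) ->
  large_increment r a s1 \/ large_increment r b s2.
Proof.
move=> [f [g [Ff Fg fg]]]; rewrite /centered_sum big_cat/=.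
rewrite -!/(centered_sum _ _ _) => ab.
have [aS|Sa] := ltP a `|centered_sum f g s1|; [left|right]; exists f, g; split=> //.
by have {}H := lt_le_trans ab (ler_normD _ _); lra.
Qed.

Lemma large_increment_suffix r (a b : R) s1 s2 :
  large_increment r (a + b) s2 ->
  large_increment r a s1 \/ large_increment r b (s1 ++ s2).
Proof.
move=> [f [g [Ff Fg fg ab]]].
have [aS|Sa] := ltP a `|centered_sum f g s1|; [left|right]; exists f, g; split=> //.
rewrite /centered_sum big_cat/= -!/(centered_sum _ _ _).
have := ler_normB (centered_sum f g s1 + centered_sum f g s2) (centered_sum f g s1).
by rewrite addrAC subrr add0r => H; have {}H := lt_le_trans ab H; lra.
Qed.

(** A supremum is strictly above a level exactly when some member is. The strict inequality in
    [large_increment] thus lets the event inherit the measurability of [sup_increment]. *)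
Lemma large_incrementE r (t : R) n : (0 < n)%N ->
  seq_event n (large_increment r t) =
  [set x | ((t / n%:R)%:E < sup_increment P F r x)%E].
Proof.
move=> n0; have n0' : 0 < n%:R :> R by rewrite ltr0n.
apply/seteqP; split => x /=.
  move=> [f [g [Ff Fg fg tfg]]].
  apply: (@lt_le_trans _ _ `|emp_process P x (fun s => f s - g s)|%:E).
    rewrite lte_fin ltr_pdivrMr// -(@ger0_norm _ n%:R) ?ltW// -normrM mulrC.
    by rewrite emp_processE.
  by apply: ereal_sup_ubound; exists f, g.
move=> /ereal_sup_gt[_ [f [g [Ff [Fg [fg ->]]]]]].
rewrite lte_fin ltr_pdivrMr// -(@ger0_norm _ n%:R) ?ltW// -normrM mulrC.
by rewrite emp_processE// => tfg; exists f, g.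
Qed.

Lemma measurable_large_increment r (t : R) n : 0 < t ->
  (forall m, (1 <= m)%N ->
    measurable_fun [set: m.-tuple S] (sup_increment P F r)) ->
  measurable (seq_event n (large_increment r t)).
Proof.
move=> t0 mF; case: n => [|n].
  rewrite (_ : seq_event _ _ = set0)//; apply/seteqP; split=> // x.
  by rewrite /seq_event/= tuple0 => /large_increment_nil[]; exact: ltW.
rewrite large_incrementE// -[X in measurable X]setTI.
exact: (emeasurable_fun_o_infty measurableT (mF n.+1 isT)).
Qed.

Lemma sup_increment_ge0 f r n (x : n.-tuple S) : F f -> 0 <= r ->
  (0 <= sup_increment P F r x)%E.
Proof.
move=> Ff r0.
(* The pair (f, f), at distance 0, is admissible, so the supremum is not over the empty set. *)
apply: (@le_trans _ _ `|emp_process P x (fun s => f s - f s)|%:E).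
  by rewrite lee_fin.
apply: ereal_sup_ubound; exists f, f; split=> //; split=> //; split=> //.
rewrite /rho_dist (_ : risk P _ = 0) ?sqrtr0//.
rewrite /risk; under eq_Rintegral do rewrite subrr expr0n/=.
by rewrite Rintegral_cst// mul0r.
Qed.

(** Markov's inequality at level t / n, obtained from [le_integral_comp_abse] with the identity. *)
Lemma prob_large_increment_le f (r t : R) n : F f -> 0 <= r -> 0 < t -> (1 <= n)%N ->
  measurable_fun [set: n.-tuple S] (sup_increment P F r) ->
  (prob_power P n (seq_event n (large_increment r t)) <=
    (n%:R / t)%:E * omega P F n r)%E.
Proof.
move=> Ff r0 t0 n1 mF; have n0 : 0 < n%:R :> R by rewrite ltr0n.
have tn0 : 0 < t / n%:R by rewrite divr_gt0.
have := @le_integral_comp_abse _ _ _ (prob_power P n) setT measurableT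
  (sup_increment P F r) (t / n%:R) id (@measurable_id _ _ _) (fun _ h => h)
  (fun _ _ _ _ h => h) mF tn0.
rewrite (_ : (\int[_]_(x in _) _ )%E = omega P F n r); last first.
  by apply: eq_integral => x _; rewrite gee0_abs//; exact: sup_increment_ge0 Ff r0.
set A := _ `&` _ => H.
have mA : measurable A.
  apply: emeasurable_fun_c_infty => //; exact: measurableT_comp.
apply: (@le_trans _ _ ((n%:R / t)%:E * ((t / n%:R)%:E * prob_power P n A))%E); last first.
  by apply: lee_wpmul2l H; rewrite lee_fin divr_ge0 ?ltW.
rewrite muleA -EFinM mulrA divfK ?gt_eqF// mulfV ?gt_eqF// mul1e.
apply: le_measure; rewrite ?inE//.
  rewrite large_incrementE// -[X in measurable X]setTI.
  exact: (emeasurable_fun_o_infty measurableT mF).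
rewrite large_incrementE// => x /= tx; split=> //=.
by rewrite gee0_abs ?(ltW tx)//; exact: sup_increment_ge0 Ff r0.
Qed.

End risk_theory.

(** * Expectations from tail bounds on dyadic shells *)

Section peeling.
Context d (T : measurableType d) (R : realType) (Q : probability T R).

(** X is at most delta off the shells and at most 2^(j+1) delta on shell j, which contributes at
    most 2 delta A (2b)^j in expectation: a geometric series of ratio 2b. *)
Lemma expectation_peeling_le (X : T -> R) (delta A b : R) :
  measurable_fun setT X -> (forall x, 0 <= X x <= 1) ->
  0 < delta -> 0 <= b -> 2 * b < 1 ->
  (forall j, (Q [set x | (2 ^+ j * delta < X x <= 2 ^+ j.+1 * delta)%R] <=
    (A * b ^+ j)%:E)%E) ->
  ('E_Q[X] <= (delta * (1 + 2 * A / (1 - 2 * b)))%:E)%E.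
Proof.
move=> mX X01 delta0 b0 b1 QX.
pose B j := [set x | (2 ^+ j * delta < X x <= 2 ^+ j.+1 * delta)%R].
have mB j : measurable (B j).
  rewrite (_ : B j = X @^-1` `]2 ^+ j * delta, 2 ^+ j.+1 * delta]).
    by rewrite -[X in measurable X]setTI; apply: mX.
  by apply/seteqP; split => x; rewrite /B/= in_itv.
have A0 : 0 <= A.
  by have := le_trans (measure_ge0 _ _) (QX 0%N); rewrite expr0 mulr1 lee_fin.
(* As 2^J delta >= 1 >= X, finitely many shells suffice. *)
pose J := Num.bound delta^-1.
have J1 : 1 <= 2 ^+ J * delta.
  by rewrite -ler_pdivrMr// div1r ltW// upper_nthrootP.
pose w j : T -> \bar R := fun x => ((2 ^+ j.+1 * delta) * \1_(B j) x)%:E.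
have w0 j x : (0 <= w j x)%E.
  by rewrite lee_fin mulr_ge0// mulr_ge0// ltW.
have mw j : measurable_fun setT (w j).
  by apply/measurable_EFinP; apply: measurable_funM => //; exact: measurable_indic.
have Xw x : ((X x)%:E <= delta%:E + \sum_(j < J) w j x)%E.
  have Xn n : X x <= 2 ^+ n * delta -> ((X x)%:E <= delta%:E + \sum_(j < n) w j x)%E.
    elim: n => [|n IH] Xn; first by rewrite big_ord0 adde0 lee_fin -[delta]mul1r.
    rewrite big_ord_recr/= addeA; have [Xle|Xgt] := leP (X x) (2 ^+ n * delta).
      by rewrite (le_trans (IH Xle))// leeDl.
    rewrite (@le_trans _ _ (w n x)) ?leeDr//; last first.
      by rewrite adde_ge0 ?sume_ge0// lee_fin ltW.
    by rewrite lee_fin indicE mem_set ?mulr1// /B/= Xgt.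
  by apply: Xn; rewrite (le_trans _ J1)//; have /andP[] := X01 x.
have sumw : (\sum_(j < J) \int[Q]_x w j x <=
    (\sum_(j < J) 2 ^+ j.+1 * delta * (A * b ^+ j))%:E)%E.
  rewrite -sumEFin; apply: lee_sum => j _.
  under eq_integral do rewrite /w EFinM.
  rewrite ge0_integralZl//; last by rewrite lee_fin mulr_ge0// ltW.
    rewrite integral_indic// setIT [leRHS]EFinM; apply: lee_wpmul2l; last exact: QX.
    by rewrite lee_fin mulr_ge0// ltW.
  by apply/measurable_EFinP; exact: measurable_indic.
have geo : \sum_(j < J) 2 ^+ j.+1 * delta * (A * b ^+ j) <=
    delta * (2 * A / (1 - 2 * b)).
  rewrite (eq_bigr (fun j : 'I_J => delta * (2 * A) * (2 * b) ^+ j)); last first.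
    by move=> j _; rewrite exprS exprMn; ring.
  rewrite -mulr_sumr [leRHS]mulrA; apply: ler_wpM2l; first by rewrite !mulr_ge0// ltW.
  rewrite -[leRHS]div1r ler_pdivlMr ?subr_gt0//.
  have -> (x y : R) : x * (1 - y) = - ((y - 1) * x) by ring.
  by rewrite -subrX1 opprB gerBl exprn_ge0 ?mulr_ge0.
rewrite unlock; apply: (@le_trans _ _ (\int[Q]_x (delta%:E + \sum_(j < J) w j x))%E).
  apply: ge0_le_integral => //.
  - by move=> x _; rewrite lee_fin; have /andP[] := X01 x.
  - exact/measurable_EFinP.
  - by apply: emeasurable_funD => //; exact: emeasurable_sum.
rewrite ge0_integralD//; [|by move=> x _; rewrite lee_fin ltW|
  by move=> x _; exact: sume_ge0|exact: emeasurable_sum].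
rewrite integral_cst// ge0_integral_sum//.
rewrite [X in (_ * X)%E](_ : _ = 1%E) ?mule1; last exact: probability_setT.
rewrite mulrDr mulr1 EFinD; apply: leeD => //.
by apply: (le_trans sumw); rewrite lee_fin.
Qed.

End peeling.

(** Lets [field] treat the square root of the sample size as its only atom. *)
Lemma natr_powR_half (R : realType) n :
  n.+1%:R `^ 2^-1 * n.+1%:R `^ 2^-1 = n.+1%:R :> R.
Proof.
rewrite -powRD ?pnatr_eq0 ?implybT//.
by rewrite (_ : 2^-1 + 2^-1 = 1 :> R) ?powRr1//; field.
Qed.

(** * Tail of the excess risk on one shell *)

Section excess_risk_tail.
Context d (S : measurableType d) (R : realType).
Variables (F : set (S -> R)) (rho kappa C : R).
Hypothesis F01 : forall f, F f -> measurable_fun setT f /\ forall s, 0 <= f s <= 1.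
Hypothesis C0 : 0 < C.
Variable P : probability S R.
Hypothesis PF : prob_class F rho kappa C P.

(** Markov's inequality and (i) give j / t times j^(-1/2), that is j^(1/2) / t up to constants. This
    grows with j, so its value at n serves for all j <= n. *)
Lemma prob_class_large_increment f (r t : R) n j : F f -> 0 < r -> 0 < t ->
  (forall m, (1 <= m)%N ->
    measurable_fun [set: m.-tuple S] (sup_increment P F r)) ->
  (j <= n)%N ->
  (prob_power P j (seq_event j (large_increment P F r t)) <=
    (C * r `^ (1 - rho) * n%:R `^ 2^-1 / t)%:E)%E.
Proof.
move=> Ff r0 t0 mF jn.
have rhs0 : 0 <= C * r `^ (1 - rho).
  by rewrite mulr_ge0 ?powR_ge0// ltW.
case: j jn => [_|j jn].
  rewrite (_ : seq_event _ _ = set0) ?measure0 ?lee_fin.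
    by rewrite divr_ge0 ?mulr_ge0 ?powR_ge0// ltW.
  apply/seteqP; split=> // x; rewrite /seq_event/= tuple0.
  by move/(large_increment_nil (ltW t0)).
have [omegaP _] := PF (n := j.+1) r0 isT.
have := prob_large_increment_le Ff (ltW r0) t0 (ltn0Sn j) (mF _ (ltn0Sn j)).
move=> /le_trans; apply.
apply: (@le_trans _ _ ((j.+1%:R / t)%:E *
    (C * r `^ (1 - rho) * j.+1%:R `^ (- 2^-1))%:E)%E).
  by apply: lee_wpmul2l omegaP; rewrite lee_fin divr_ge0// ltW.
rewrite -EFinM lee_fin.
have -> : j.+1%:R / t * (C * r `^ (1 - rho) * j.+1%:R `^ (- 2^-1)) =
    C * r `^ (1 - rho) * j.+1%:R `^ 2^-1 / t.
  have h0 : j.+1%:R `^ 2^-1 != 0 :> R by rewrite gt_eqF// powR_gt0.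
  rewrite powRN -{1}natr_powR_half; field.
  by rewrite h0 gt_eqF.
apply: ler_wpM2r; first by rewrite invr_ge0 ltW.
by apply: ler_wpM2l => //; apply: ge0_ler_powR; rewrite ?nnegrE// ler_nat.
Qed.

Lemma excess_risk_large_increment n (x : n.-tuple S) f (delta r : R) :
  (1 <= n)%N -> F f -> (forall g, F g -> emp_risk x f <= emp_risk x g) ->
  0 < delta -> C * (2 * delta) `^ (2 * kappa)^-1 <= r ->
  delta < excess_risk P F f <= 2 * delta ->
  large_increment P F r (n%:R * delta / 2) x.
Proof.
move=> n1 Ff erm delta0 rC /andP[fdelta f2delta].
have delta2 : 0 < delta / 2 by rewrite divr_gt0.
(* The infimum of the risk may not be attained; a slack of delta / 2 still leaves a risk gap above
   delta / 2. *)
have [g Fg gdelta] := near_minimizer_exists P F01 Ff delta2.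
have delta20 : 0 < 2 * delta by rewrite mulr_gt0.
have [_ diamP] := PF (n := n) delta20 n1.
exists f, g; split => //.
  rewrite -lee_fin; apply: le_trans (le_trans diamP _); last by rewrite lee_fin.
  apply: ereal_sup_ubound; exists f, g; split=> //; split=> //; split=> //.
  by rewrite (le_trans (ltW gdelta))//; lra.
rewrite -emp_processE// normrM ger0_norm// -mulrA ltr_pM2l ?ltr0n//.
(* The increment is negative: f has the larger risk but not the larger empirical risk. *)
rewrite ltr_normr; apply/orP; right.
have -> : emp_process P x (fun s => f s - g s) =
    emp_risk x f - emp_risk x g - (risk P f - risk P g).
  by rewrite /emp_process (riskB P F01)// /emp_risk sumrB mulrBr.
have := erm _ Fg; move: fdelta gdelta; rewrite /excess_risk; lra.
Qed.

Lemma prob_excess_risk_le n (fn : n.-tuple S -> S -> R) (delta r : R) :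
  (1 <= n)%N ->
  (forall x, F (fn x) /\ forall g, F g -> emp_risk x (fn x) <= emp_risk x g) ->
  0 < r ->
  (forall m, (1 <= m)%N ->
    measurable_fun [set: m.-tuple S] (sup_increment P F r)) ->
  measurable_fun setT (fun x => excess_risk P F (fn x)) ->
  0 < delta -> 8 <= n%:R * delta ->
  C * (2 * delta) `^ (2 * kappa)^-1 <= r ->
  (prob_power P n
    [set x | (delta < excess_risk P F (fn x) <= 2 * delta)%R] <=
   (2 * (16 * C * r `^ (1 - rho) * n%:R `^ (- 2^-1) / delta) ^+ 2)%:E)%E.
Proof.
move=> n1 erm r0 mF mX delta0 ndelta rC.
have n0 : 0 < n%:R :> R by rewrite ltr0n.
(* Since n delta >= 8, 2 <= n delta / 4 and 3t + 2 <= 7 n delta / 16 < n delta / 2. *)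
set t := n%:R * delta / 16.
have t0 : 0 < t by rewrite divr_gt0// mulr_gt0.
(* An empty event has probability 0; otherwise a sample in it supplies the member [fn x0] of [F]. *)
have [->|/set0P[x0 _]] := eqVneq
    [set x | delta < excess_risk P F (fn x) <= 2 * delta] set0.
  by rewrite measure0 lee_fin mulr_ge0// sqr_ge0.
have [Ff0 _] := erm x0.
set q := 16 * _ * _ * _ / _.
have tq j : (j <= n)%N -> (prob_power P j
    (seq_event j (large_increment P F r t)) <= q%:E)%E.
  move=> /(prob_class_large_increment Ff0 r0 t0 mF) /le_trans; apply.
  rewrite lee_fin le_eqVlt; apply/orP; left; apply/eqP; rewrite /q /t powRN.
  have h0 : n%:R `^ 2^-1 != 0 :> R by rewrite gt_eqF// powR_gt0.
  rewrite -(prednK n1) in h0 *.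
  by rewrite -{2}natr_powR_half; field; rewrite h0 gt_eqF.
have mL s : 0 < s -> forall m, measurable (seq_event m (large_increment P F r s)).
  by move=> s0 m; exact: measurable_large_increment.
apply: (@le_trans _ _ (prob_power P n
    (seq_event n (large_increment P F r (3 * t + 2))))); last first.
  apply: hoffmann_jorgensen t0 tq => //.
  - by move=> s; exact: large_increment_nil.
  - by move=> a b s1 s2; exact: large_increment_cat.
  - by move=> a b s1 s2; exact: large_increment_suffix.
  - by move=> x; exact: large_increment1.
have t2 : 0 < 3 * t + 2 by rewrite addr_gt0// mulr_gt0.
apply: le_measure; rewrite ?inE.
- rewrite (_ : [set x | _] = (fun x => excess_risk P F (fn x)) @^-1`
    `]delta, 2 * delta]%classic).
    by rewrite -[X in measurable X]setTI; apply: mX.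
  by apply/seteqP; split => x /=; rewrite in_itv.
- exact: mL.
move=> x ex; have [Ff fmin] := erm x.
apply: large_increment_le (excess_risk_large_increment n1 Ff fmin delta0 rC ex).
by rewrite /t; lra.
Qed.

End excess_risk_tail.

(** * Exponents and the choice of the rate *)

Section rates.
Context (R : realType) (rho kappa C : R).
Hypotheses (rho01 : 0 < rho < 1) (kappa1 : 1 <= kappa) (C0 : 0 < C).

Local Notation alpha := ((1 - rho) / (2 * kappa)).
Local Notation rate n := (n%:R `^ (- (kappa / (2 * kappa + rho - 1)))).

(** The left side is 2^(2 alpha - 1) with 2 alpha = (1 - rho) / kappa < 1. Without the square it
    would be 2^alpha > 1. *)
Lemma peeling_ratio_lt1 : 2 * (2 `^ (alpha - 1)) ^+ 2 < 1.
Proof.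
have k0 : 0 < kappa by apply: lt_le_trans kappa1.
have -> : 2 * (2 `^ (alpha - 1)) ^+ 2 = (2 `^ (1 - 2 * alpha))^-1.
  rewrite -powRN opprB expr2 -powRD; last by rewrite pnatr_eq0 implybT.
  rewrite -{1}[2]powRr1// -powRD; last by rewrite pnatr_eq0 implybT.
  by congr (_ `^ _); ring.
have e1 : 1 `^ (1 - 2 * alpha) = 1 :> R by rewrite powR1.
rewrite invf_lt1 ?powR_gt0// -[ltLHS]e1.
apply: gt0_ltr_powR; rewrite ?nnegrE ?ltr1n//.
rewrite subr_gt0 mulrA ltr_pdivrMr ?mulr_gt0//. by move: rho01 kappa1; lra.
Qed.

(** The exponent of the rate is at least -1 because kappa + rho >= 1. With the factor 8 in the first
    scale, this gives n delta >= 8 at every scale. *)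
Lemma ge1_natr_rate n : (1 <= n)%N -> 1 <= n%:R * rate n :> R.
Proof.
move=> n1; have n1' : 1 <= n%:R :> R by rewrite ler1n.
have D0 : 0 < 2 * kappa + rho - 1 by move: rho01 kappa1; lra.
rewrite -{1}[n%:R]powRr1// -powRD; last by rewrite pnatr_eq0 -lt0n n1 implybT.
rewrite -[leLHS](powRr0 n%:R); apply: ler_powR => //.
rewrite subr_ge0 ler_pdivrMr// mul1r. by move: rho01 kappa1; lra.
Qed.

(** Since 1 - alpha = (2 kappa + rho - 1) / (2 kappa), the rate raised to alpha - 1 is n^(1/2). It
    cancels n^(-1/2), and only a geometric factor in j remains. *)
Lemma rate_balance n j (delta := 2 ^+ j * (8 * rate n)) : (1 <= n)%N ->
  16 * C * (C * (2 * delta) `^ (2 * kappa)^-1) `^ (1 - rho) *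
    n%:R `^ (- 2^-1) / delta =
  16 * C * C `^ (1 - rho) * 2 `^ alpha * 8 `^ (alpha - 1) *
    (2 `^ (alpha - 1)) ^+ j.
Proof.
move=> n1; have n0 : 0 < n%:R :> R by rewrite ltr0n.
have k0 : 0 < kappa by apply: lt_le_trans kappa1.
have r0 : 0 < rate n by rewrite powR_gt0.
have d0 : 0 < delta by rewrite !mulr_gt0// exprn_gt0.
rewrite powRM ?powR_ge0 ?(ltW C0)// -powRrM.
rewrite (_ : (2 * kappa)^-1 * (1 - rho) = alpha); last by rewrite mulrC.
rewrite powRM ?(ltW d0)//.
have -> : delta `^ alpha = delta * delta `^ (alpha - 1).
  rewrite -{2}[delta]powRr1 ?(ltW d0)// -powRD ?(gt_eqF d0) ?implybT//.
  by congr (_ `^ _); ring.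
have -> : delta `^ (alpha - 1) =
    (2 `^ (alpha - 1)) ^+ j * 8 `^ (alpha - 1) * n%:R `^ 2^-1.
  rewrite /delta !powRM ?exprn_ge0 ?mulr_ge0 ?(ltW r0)// mulrA.
  congr (_ * _ * _).
    by rewrite -powR_mulrn// powRAC powR_mulrn ?powR_ge0.
  rewrite -powRrM; congr (_ `^ _);field.
  by rewrite gt_eqF//= gt_eqF//; by move: rho01 kappa1; lra.
rewrite powRN; field.
by rewrite !gt_eqF ?powR_gt0.
Qed.

End rates.

(** * Summation over the dyadic scales, uniformly in P *)

Theorem theorem8 (R : realType) (d : measure_display) (S : measurableType d)
    (F : set (S -> R)) (rho kappa C : R)
    (fhat : forall n : nat, n.-tuple S -> S -> R) :
  (forall f, F f -> measurable_fun setT f /\ forall s, 0 <= f s <= 1) ->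
  0 < rho < 1 -> 1 <= kappa -> 0 < C ->
  is_erm F fhat ->
  (forall P, prob_class F rho kappa C P ->
     forall (n : nat) (delta : R), (1 <= n)%N -> 0 < delta ->
     measurable_fun [set: n.-tuple S] (sup_increment P F delta)) ->
  (forall P, prob_class F rho kappa C P -> forall n : nat, (1 <= n)%N ->
     measurable_fun [set: n.-tuple S] (fun x => excess_risk P F (fhat n x))) ->
  exists K : R, \forall n \near \oo,
    (ereal_sup [set 'E_(prob_power P n)[fun x => excess_risk P F (fhat n x)]
               | P in prob_class F rho kappa C]
     <= (K * n%:R `^ (- (kappa / (2 * kappa + rho - 1))))%:E)%E.
Proof.
move=> F01 rho01 kappa1 C0 erm mF mX.
pose alpha : R := (1 - rho) / (2 * kappa).
pose M := 16 * C * C `^ (1 - rho) * 2 `^ alpha * 8 `^ (alpha - 1).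
pose b := ((2 : R) `^ (alpha - 1)) ^+ 2.
have b1 : 2 * b < 1 by exact: peeling_ratio_lt1.
(* The peeling bound with first scale 8 times the rate and A = 2 M^2; it depends only on rho, kappa
   and C. *)
exists (8 * (1 + 2 * (2 * M ^+ 2) / (1 - 2 * b))).
exists 1%N => // n /= n1; apply: ge_ereal_sup => _ [P PF <-].
set rate := n%:R `^ _.
have n0 : 0 < n%:R :> R by rewrite ltr0n.
have rate0 : 0 < rate by rewrite powR_gt0.
have -> : 8 * (1 + 2 * (2 * M ^+ 2) / (1 - 2 * b)) * rate =
    8 * rate * (1 + 2 * (2 * M ^+ 2) / (1 - 2 * b)) by ring.
have ermx x := erm n x n1.
apply: expectation_peeling_le => //.
- exact: mX.
- by move=> x; have [Ff _] := ermx x; rewrite excess_risk_ge0//= excess_risk_le1.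
- by rewrite mulr_gt0.
- by rewrite sqr_ge0.
move=> j; set delta := 2 ^+ j * (8 * rate).
have delta0 : 0 < delta by rewrite !mulr_gt0// exprn_gt0.
have r0 : 0 < C * (2 * delta) `^ (2 * kappa)^-1 by rewrite mulr_gt0// powR_gt0// mulr_gt0.
rewrite exprS -mulrA.
have ndelta : 8 <= n%:R * delta.
  have := ge1_natr_rate rho01 kappa1 n1; rewrite -/rate => nrate.
  have j1 : 1 <= 2 ^+ j :> R by rewrite exprn_ege1// ler1n.
  have := ler_wpM2l (ler0n R 8) (ler_pM ler01 ler01 j1 nrate).
  by rewrite !mulr1 (_ : n%:R * delta = 8 * (2 ^+ j * (n%:R * rate)))// /delta; ring.
(* The radius is exactly the diameter bound of (ii) at level 2 delta. *)
apply: (le_trans (prob_excess_risk_le F01 C0 PF n1 ermx r0 _ (mX _ PF _ n1) delta0 ndelta (lexx _))).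
  by move=> m m1; exact: mF.
by rewrite rate_balance// -/alpha -/M exprMn mulrA /b -!exprM mulnC.
Qed.
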